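(* Let $(W,S)$ be a Coxeter system with $S$ finite, and suppose that $W$ is infinite. Then $$\sum_{T\subseteq S}\frac{(-1)^{|T|}}{W_T(t)}=0$$ as an identity of formal power series in $t$.
   Context: A Coxeter system $(W,S)$: $W$ is the group generated by the finite set $S$ subject to the relations $(st)^{m_{st}}=1$ for $s,t\in S$, where $m_{ss}=1$ and, for $s\neq t$, $m_{st}=m_{ts}\in\{2,3,\ldots,\infty\}$ ($m_{st}=\infty$ means no relation). For $w\in W$, $\ell(w)$ denotes the word length of $w$ with respect to $S$. For $T\subseteq S$, $W_T$ is the subgroup of $W$ generated by $T$ (so $W_\emptyset=\{1\}$ and $W_S=W$); it is a Coxeter group with generating set $T$, and its word length with respect to $T$ is the restriction of $\ell$. The growth series of $W_T$ is the formal power series $W_T(t)=\sum_{w\in W_T}t^{\ell(w)}$ (in particular $W(t)=\sum_{w\in W}t^{\ell(w)}$); it has constant term $1$, hence is invertible in $\mathbb{Z}[[t]]$. *)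

(* Defs.v *)
From HB Require Import structures.
From mathcomp Require Import all_boot all_order all_algebra.
From mathcomp Require Import finmap.
From mathcomp Require Import boolp classical_sets functions cardinality.

Set Implicit Arguments.
Unset Strict Implicit.
Unset Printing Implicit Defensive.

Import GRing.Theory.

Section FormalPowerSeries.
Variable R : comNzRingType.
Local Open Scope ring_scope.

(* A record, so that the pointwise ring structure on nat -> R cannot interfere
   with the Cauchy product. *)
Record fps := Fps { coefs : nat -> R }.

Lemma fpsP (f g : fps) : coefs f =1 coefs g -> f = g.
Proof. by case: f g => [f] [g] /= /funext ->. Qed.

HB.instance Definition _ := gen_eqMixin fps.
HB.instance Definition _ := gen_choiceMixin fps.

Definition fps0 := Fps (fun=> 0).
Definition fps1 := Fps (fun n => (n == 0)%:R).
Definition fps_opp f := Fps (fun n => - coefs f n).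
Definition fps_add f g := Fps (fun n => coefs f n + coefs g n).
Definition fps_mul f g :=
  Fps (fun n => \sum_(i < n.+1) coefs f i * coefs g (n - i)%N).

Lemma fps_addA : associative fps_add.
Proof. by move=> f g h; apply: fpsP => n /=; rewrite addrA. Qed.
Lemma fps_addC : commutative fps_add.
Proof. by move=> f g; apply: fpsP => n /=; rewrite addrC. Qed.
Lemma fps_add0 : left_id fps0 fps_add.
Proof. by move=> f; apply: fpsP => n /=; rewrite add0r. Qed.
Lemma fps_addN : left_inverse fps0 fps_opp fps_add.
Proof. by move=> f; apply: fpsP => n /=; rewrite addNr. Qed.

HB.instance Definition _ :=
  GRing.isZmodule.Build fps fps_addA fps_addC fps_add0 fps_addN.

Let tr N f := \poly_(i < N.+1) coefs f i.

Let coef_tr N f n : (n <= N)%N -> (tr N f)`_n = coefs f n.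
Proof. by move=> nN; rewrite coef_poly ltnS nN. Qed.

Let coef_mul N f g n :
  (n <= N)%N -> coefs (fps_mul f g) n = (tr N f * tr N g)`_n.
Proof.
move=> nN; rewrite coefM /=; apply: eq_bigr => -[i /= iS] _.
by rewrite !coef_tr // (leq_trans _ nN) // leq_subr.
Qed.

Let coefM_eq (p p' q q' : {poly R}) n :
    (forall i, (i <= n)%N -> p`_i = p'`_i) ->
    (forall i, (i <= n)%N -> q`_i = q'`_i) ->
  (p * q)`_n = (p' * q')`_n.
Proof.
move=> pp' qq'; rewrite !coefM; apply: eq_bigr => -[i /= iS] _.
by rewrite pp' // qq' // leq_subr.
Qed.

Lemma fps_mulA : associative fps_mul.
Proof.
move=> f g h; apply: fpsP => n; rewrite !(coef_mul _ _ (leqnn n)).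
transitivity ((tr n f * (tr n g * tr n h))`_n).
  by apply: coefM_eq => // i le_in; rewrite coef_tr // (coef_mul _ _ le_in).
rewrite mulrA; apply: coefM_eq => // i le_in.
by rewrite coef_tr // (coef_mul _ _ le_in).
Qed.

Lemma fps_mulC : commutative fps_mul.
Proof.
by move=> f g; apply: fpsP => n; rewrite !(coef_mul _ _ (leqnn n)) mulrC.
Qed.

Lemma fps_mul1 : left_id fps1 fps_mul.
Proof.
move=> f; apply: fpsP => n /=; rewrite big_ord_recl /= mul1r subn0.
by rewrite big1 ?addr0 // => i _; rewrite mul0r.
Qed.

Lemma fps_mulDl : left_distributive fps_mul fps_add.
Proof.
move=> f g h; apply: fpsP => n /=; rewrite -big_split /=.
by apply: eq_bigr => i _; rewrite mulrDl.
Qed.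

Lemma fps1_neq0 : fps1 != fps0.
Proof.
by apply/eqP => /(congr1 (fun f => coefs f 0)) /= /eqP; rewrite oner_eq0.
Qed.

HB.instance Definition _ := GRing.Zmodule_isComNzRing.Build fps
  fps_mulA fps_mulC fps_mul1 fps_mulDl fps1_neq0.

Definition fps_unit : pred fps := fun f => `[< exists g, g * f = 1 >].
Definition fps_inv (f : fps) : fps := xget f [set g | g * f = 1]%classic.

Lemma fps_mulV : {in fps_unit, left_inverse 1 fps_inv *%R}.
Proof.
move=> f /asboolP [g gf1]; rewrite /fps_inv.
by case: xgetP => [_ -> //|/(_ g)].
Qed.

Lemma fps_unitP f g : g * f = 1 -> fps_unit f.
Proof. by move=> gf1; apply/asboolP; exists g. Qed.

Lemma fps_inv_out : {in [predC fps_unit], fps_inv =1 id}.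
Proof.
move=> f /negP nUf; rewrite /fps_inv; case: xgetP => // g _ gf1.
by case: nUf; apply: fps_unitP gf1.
Qed.

HB.instance Definition _ := GRing.ComNzRing_hasMulInverse.Build fps
  fps_mulV fps_unitP fps_inv_out.

Lemma fps_unit_const1 (f : fps) : coefs f 0 = 1 -> f \is a GRing.unit.
Proof.
move=> f01.
pose step (s : seq R) :=
  rcons s ((size s == 0)%:R - \sum_(i < size s) s`_i * coefs f (size s - i)%N).
pose s_ n := iter n step [::].
have size_s n : size (s_ n) = n by elim: n => //= n IHn; rewrite size_rcons IHn.
have nth_s n k i : (i < n)%N -> (s_ (n + k)%N)`_i = (s_ n)`_i.
  move=> lt_in; elim: k => [|k IHk]; first by rewrite addn0.
  by rewrite addnS [s_ _.+1]/= nth_rcons size_s ltn_addr.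
pose g := Fps (fun n => (s_ n.+1)`_n).
have nth_g n i : (i < n)%N -> (s_ n)`_i = coefs g i.
  by move=> lt_in; rewrite -(subnKC lt_in) nth_s.
suff gf1 : g * f = 1 by apply/unitrPr; exists g; rewrite mulrC.
apply: fpsP => n.
change (\sum_(i < n.+1) coefs g i * coefs f (n - i)%N = (n == 0)%:R).
rewrite big_ord_recr /= subnn f01 mulr1 nth_rcons size_s ltnn eqxx.
suff -> : \sum_(i < n) (s_ n)`_i * coefs f (n - i)%N =
          \sum_(i < n) coefs g i * coefs f (n - i)%N by rewrite addrC subrK.
by apply: eq_bigr => i _; rewrite nth_g.
Qed.

End FormalPowerSeries.

Section Presentations.
Variable S : Type.

(* Words in the letters (s, false), standing for s, and (s, true), standing for
   s^-1. *)
Definition gword := seq (S * bool).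

(* Equality in the free group on S modulo the normal closure of the relators. *)
Inductive gword_eq (rel : gword -> Prop) : gword -> gword -> Prop :=
| gword_refl u : gword_eq rel u u
| gword_sym u v : gword_eq rel u v -> gword_eq rel v u
| gword_trans u v w : gword_eq rel u v -> gword_eq rel v w -> gword_eq rel u w
| gword_cat u u' v v' :
    gword_eq rel u u' -> gword_eq rel v v' -> gword_eq rel (u ++ v) (u' ++ v')
| gword_cancel s b : gword_eq rel [:: (s, b); (s, ~~ b)] [::]
| gword_relator r : rel r -> gword_eq rel r [::].

Local Open Scope group_scope.

Definition gword_eval (W : groupType) (gen : S -> W) (u : gword) : W :=
  \prod_(x <- u) (if x.2 then (gen x.1)^-1 else gen x.1).

(* The map from the presented group <S | rel> to W induced by gen is an
   isomorphism. *)
Definition presented_by (W : groupType) (gen : S -> W) (rel : gword -> Prop) :=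
  (forall w : W, exists u, gword_eval gen u = w) /\
  (forall u v, gword_eval gen u = gword_eval gen v <-> gword_eq rel u v).

End Presentations.

(* The value m s t = 0 encodes m_st = oo: the corresponding relator (st)^0 is
   the empty word, i.e. there is no relation. *)
Definition coxeter_matrix (S : finType) (m : S -> S -> nat) : Prop :=
  [/\ forall s, m s s = 1,
      forall s t, m s t = m t s
    & forall s t, s != t -> m s t = 0 \/ 2 <= m s t].

Definition coxeter_relator (S : finType) (m : S -> S -> nat) (r : gword S) :=
  exists s t, r = flatten (nseq (m s t) [:: (s, false); (t, false)]).

(* The generating set is given as a family gen : S -> W indexed by S, so that
   its subsets are the T : {set S}. *)
Definition coxeter_system (W : groupType) (S : finType) (gen : S -> W) : Prop :=
  exists m : S -> S -> nat,
    coxeter_matrix m /\ presented_by gen (coxeter_relator m).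

Section Growth.
Variables (W : groupType) (S : finType) (gen : S -> W).
Local Open Scope classical_set_scope.
Local Open Scope group_scope.

Definition is_word_length (w : W) (n : nat) : Prop :=
  (exists2 u : seq S, size u = n & \prod_(s <- u) gen s = w) /\
  (forall u : seq S, \prod_(s <- u) gen s = w -> n <= size u).

(* The default value 0 is irrelevant when every element of W is a product of
   generators, as is the case in a Coxeter system. *)
Definition word_length (w : W) : nat := xget 0%N [set n | is_word_length w n].

Definition parabolic (T : {set S}) : set W :=
  smallest (fun H : set W => group_closed (mem H)) (gen @` [set` T]).

Definition parabolic_sphere (T : {set S}) (n : nat) : set W :=
  [set w | parabolic T w /\ word_length w = n].

(* Spheres are finite in a Coxeter system, see finite_parabolic_sphere below. *)
Definition growth_series (T : {set S}) : fps int :=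
  Fps (fun n => (#|` fset_set (parabolic_sphere T n)|)%:R%R).

End Growth.

Section GrowthFacts.
Variables (W : groupType) (S : finType) (gen : S -> W).
Hypothesis hWS : coxeter_system gen.
Local Open Scope classical_set_scope.
Local Open Scope group_scope.

Lemma coxeter_gen_mul s : gen s * gen s = 1.
Proof.
have [m [[mss _ _] [_ /(_ [:: (s, false); (s, false)] [::]) [_]]]] := hWS.
rewrite /gword_eval !big_cons !big_nil /= mulg1; apply.
by apply: gword_relator; exists s, s; rewrite mss.
Qed.

Lemma coxeter_gen_word w : exists u : seq S, \prod_(s <- u) gen s = w.
Proof.
have [m [_ [/(_ w) [u <-] _]]] := hWS.
exists (map fst u); rewrite big_map; apply: eq_bigr => -[s [|]] _ //=.
by apply/(mulgI (gen s)); rewrite coxeter_gen_mul mulgV.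
Qed.

Lemma word_lengthP w : is_word_length gen w (word_length gen w).
Proof.
pose P n := `[< exists2 u : seq S, size u = n & \prod_(s <- u) gen s = w >].
have exP : exists n, P n.
  by have [u uw] := coxeter_gen_word w; exists (size u); apply/asboolP; exists u.
have lenP : is_word_length gen w (ex_minn exP).
  case: ex_minnP => n /asboolP nw n_min; split=> // u uw.
  by apply: n_min; apply/asboolP; exists u.
by rewrite /word_length; case: xgetP => [n _ //|/(_ (ex_minn exP))].
Qed.

Lemma finite_parabolic_sphere T n : finite_set (parabolic_sphere gen T n).
Proof.
apply: (@sub_finite_set _ _
  [set` [seq \prod_(s <- u) gen s | u : n.-tuple S]]); last exact: finite_seq.
move=> w [_ wn] /=; have [[u un uw] _] := word_lengthP w.
have u_n : size u == n by rewrite un wn.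
by apply/mapP; exists (Tuple u_n); rewrite ?mem_enum.
Qed.

Lemma growth_series0 T : coefs (growth_series gen T) 0 = 1%R.
Proof.
rewrite /=; have -> : parabolic_sphere gen T 0 = [set 1].
  rewrite predeqE => w; split=> [[_ w0]|->]; last first.
    split; first by move=> H [[H1 _] _]; rewrite inE in H1.
    by apply/eqP; rewrite -leqn0; apply: (proj2 (word_lengthP 1) [::]); rewrite big_nil.
  have [[u un uw] _] := word_lengthP w; rewrite w0 in un.
  by rewrite -uw (size0nil un) big_nil.
by rewrite fset_set1 cardfs1.
Qed.

Lemma growth_series_unit T : growth_series gen T \is a GRing.unit.
Proof. exact/fps_unit_const1/growth_series0. Qed.

End GrowthFacts.

(* Main.v *)
Require Import Defs.
From mathcomp Require Import all_boot all_order all_algebra.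
From mathcomp Require Import boolp classical_sets cardinality.
From mathcomp Require Import finmap zify.

Import GRing.Theory.

Set Implicit Arguments.
Unset Strict Implicit.
Unset Printing Implicit Defensive.

(** Multiplying by W(t), it suffices to show that the alternating sum of the
series W(t) / W_T(t) vanishes. Each of them counts by length the elements w
that are minimal in their coset W_T w, i.e. such that l(sw) > l(w) for all s
in T. Hence w contributes the sum of (-1)^|T| over the sets T of generators
that are not left descents of w, which is 0 unless every generator is a left descent of w; but
such a w would be a longest element and W would be finite.

The exchange condition comes from the inversion cocycle: modulo 2, the number of
occurrences of a reflection r among the s_1 ... s_i ... s_1 attached to a word
s_1 ... s_k is unchanged by the defining relations, hence depends only on the
element of W. *)

(** * The inversion cocycle of a Coxeter system *)

Section Inversions.
Variables (W : groupType) (S : finType) (gen : S -> W).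
Local Open Scope group_scope.

Local Notation wprod u := (\prod_(s <- u) gen s).
Local Notation len := (word_length gen).

(* Parity of the number of occurrences of r among the reflections
   s_1 ... s_i s_(i-1) ... s_1 attached to the word s_1 ... s_k. *)
Fixpoint inversion_parity (u : seq S) (r : W) : bool :=
  if u is s :: v then (gen s == r) (+) inversion_parity v (r ^ gen s)
  else false.

(* The choice of the word is irrelevant, see inversion_prod. *)
Definition inversion (w r : W) : bool :=
  inversion_parity (xget [::] [set u | wprod u = w]%classic) r.

Lemma inversion_parity_cat u v r :
  inversion_parity (u ++ v) r =
    inversion_parity u r (+) inversion_parity v (r ^ wprod u).
Proof.
elim: u r => [|s u IHu] r /=; first by rewrite big_nil conjg1.
by rewrite IHu big_cons conjgM addbA.
Qed.

Hypothesis hWS : coxeter_system gen.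

Lemma coxeter_genV s : (gen s)^-1 = gen s.
Proof. by apply: mulg1_eq; apply: coxeter_gen_mul. Qed.

(** Put x = st. Peeling off two letters accounts for j = 0, 1 and replaces [r] by [r ^ x]; since x s
    x = s, undoing this conjugation turns x^j s into x^(j+2) s. *)
Lemma inversion_parity_dihedral s t k r :
  inversion_parity (flatten (nseq k [:: s; t])) r =
    \big[addb/false]_(0 <= j < k.*2) ((gen s * gen t) ^+ j * gen s == r).
Proof.
set x := gen s * gen t.
have sxV : gen s = x * gen s * x.
  rewrite /x -!mulgA [gen s * (gen s * _)]mulgA coxeter_gen_mul // mul1g.
  by rewrite coxeter_gen_mul // mulg1.
elim: k r => [|k IHk] r; first by rewrite big_geq.
rewrite doubleS !big_nat_recl //= IHk expg0 mul1g expg1; congr (_ (+) (_ (+) _)).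
  rewrite -(inj_eq (@conjg_inj _ (gen s)) _ r); congr (_ == _).
  by rewrite [RHS]conjgE /x -!mulgA mulKg coxeter_gen_mul // mulg1.
apply: eq_bigr => j _; rewrite -(inj_eq (@conjg_inj _ x) _ r) -conjgM; congr (_ == _).
rewrite [RHS]conjgE expgS -!(mulgA x) mulKg expgSr -!(mulgA (x ^+ j)).
by rewrite -sxV.
Qed.

(** The 2k reflections x^j s repeat with period k, so the two halves of the list cancel modulo 2. *)
Lemma inversion_parity_relator s t k r : (gen s * gen t) ^+ k = 1 ->
  inversion_parity (flatten (nseq k [:: s; t])) r = false.
Proof.
move=> xk1; rewrite inversion_parity_dihedral -addnn.
rewrite (big_cat_nat (n := k)) ?leq_addr //=.
rewrite -{2}(add0n k) big_addn addnK.
under [X in _ (+) X]eq_bigr do rewrite expgnDr xk1 mulg1.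
by rewrite addbb.
Qed.

(** Equal products are related by a derivation in the presentation; induction on it shows that each
    rule preserves the parity. *)
Lemma eq_prod_inversion_parity u v r :
  wprod u = wprod v -> inversion_parity u r = inversion_parity v r.
Proof.
have [m [_ [_ presW]]] := hWS.
(* Formal inverses may be forgotten because generators are involutions. *)
pose unsign (a : gword S) := map fst a.
have evalE a : gword_eval gen a = wprod (unsign a).
  rewrite /gword_eval big_map; apply: eq_bigr => -[s []] _ //=.
  exact: coxeter_genV.
have unsignK w : unsign (map (pair^~ false) w) = w.
  by rewrite /unsign -map_comp map_id.
move=> uv; rewrite -(unsignK u) -(unsignK v).
have /presW eq_uv : gword_eval gen (map (pair^~ false) u) =
              gword_eval gen (map (pair^~ false) v).
  by rewrite !evalE !unsignK.
elim: eq_uv r => {u v uv} [//|a b _ + r|a b c _ IHa _ IHb r|a a' b b' eq_a IHa _ IHb r|s b r|a rel_a r].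
- by move->.
- by rewrite IHa.
- rewrite /unsign !map_cat.
  (* It remains to see that [r] is conjugated by the same element on both sides: related prefixes
     have equal products. *)
  rewrite !inversion_parity_cat IHa IHb; congr (_ (+) inversion_parity _ (_ ^ _)).
  by rewrite -!evalE; apply/presW.
- rewrite /= addbF -(inj_eq (@conjg_inj _ (gen s)) _ r) conjgE.
  by rewrite coxeter_gen_mul // mulg1 coxeter_genV addbb.
- have [s [t def_a]] := rel_a.
  have a1 : wprod (unsign a) = 1.
    have /presW := gword_relator rel_a; rewrite !evalE => ->.
    by rewrite big_nil.
  have def_ua : unsign a = flatten (nseq (m s t) [:: s; t]).
    by rewrite def_a; elim: (m s t) => //= k; rewrite /unsign => ->.
  rewrite def_ua; apply: inversion_parity_relator; rewrite -a1 def_ua.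
  elim: (m s t) => [|k IHk]; first by rewrite big_nil.
  by rewrite expgS /= !big_cons IHk mulgA.
Qed.

Lemma inversion_prod u r : inversion (wprod u) r = inversion_parity u r.
Proof.
apply: eq_prod_inversion_parity.
by case: xgetP => [v _ //|/(_ u) []].
Qed.

Lemma inversion_gen s r : inversion (gen s) r = (gen s == r).
Proof.
have := inversion_prod [:: s] r.
by rewrite big_cons big_nil mulg1 /= addbF.
Qed.

(** The cocycle identity, the main tool for descents of products below. *)
Lemma inversionM v w r :
  inversion (v * w) r = inversion v r (+) inversion w (r ^ v).
Proof.
have [a <-] := coxeter_gen_word hWS v; have [b <-] := coxeter_gen_word hWS w.
by rewrite -big_cat !inversion_prod inversion_parity_cat.
Qed.

Lemma inversion_genM s w :
  inversion (gen s * w) (gen s) = ~~ inversion w (gen s).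
Proof. by rewrite inversionM inversion_gen eqxx conjgE mulgA mulVg mul1g. Qed.

(** * Exchange condition, length and longest elements *)

(** An odd count means that [r] is some s_1 ... s_i ... s_1, and multiplying by it deletes the
    letter s_i. *)
Lemma strong_exchange u r : inversion_parity u r ->
  exists v, [/\ subseq v u, size v < size u & wprod v = r * wprod u].
Proof.
elim: u r => //= s u IHu r; case: eqP => [<- _|_ /IHu[v [sub_vu lt_vu def_v]]].
  exists u; split=> //; first exact: subseq_cons.
  by rewrite big_cons mulgA coxeter_gen_mul // mul1g.
exists (s :: v); split; rewrite /= ?eqxx ?big_cons //.
by rewrite def_v conjgE !mulgA mulgV mul1g.
Qed.

Lemma len_prod u : len (wprod u) <= size u.
Proof. exact: (proj2 (word_lengthP hWS _)). Qed.

Lemma len_word w : exists2 u, size u = len w & wprod u = w.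
Proof. exact: (proj1 (word_lengthP hWS w)). Qed.

Lemma len1 : len 1 = 0.
Proof. by have := len_prod [::]; rewrite big_nil leqn0 => /eqP. Qed.

Lemma len_eq0 w : len w = 0 -> w = 1.
Proof.
move=> w0; have [u] := len_word w; rewrite w0 => /size0nil-> <-.
by rewrite big_nil.
Qed.

Lemma lenM v w : len (v * w) <= len v + len w.
Proof.
have [a <- <-] := len_word v; have [b <- <-] := len_word w.
by rewrite -big_cat -size_cat len_prod.
Qed.

Lemma len_gen s : len (gen s) <= 1.
Proof. by have := len_prod [:: s]; rewrite big_cons big_nil mulg1. Qed.

Lemma len_inversion w r : inversion w r -> len (r * w) < len w.
Proof.
have [u <- <-] := len_word w; rewrite inversion_prod.
by case/strong_exchange=> v [_ lt_vu <-]; apply: leq_ltn_trans lt_vu; apply: len_prod.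
Qed.

Lemma len_genM_inversion s w : inversion w (gen s) -> len w = (len (gen s * w)).+1.
Proof.
move=> /len_inversion lt_sw; apply/eqP; rewrite eqn_leq lt_sw andbT.
rewrite -{1}(mul1g w) -(coxeter_gen_mul hWS s) -mulgA.
by apply: leq_trans (lenM _ _) _; rewrite -add1n leq_add2r len_gen.
Qed.

(* Every x is a prefix of w, so w is a longest element. *)
Lemma len_prefix w x : (forall s, inversion w (gen s)) ->
  len (x^-1 * w) + len x <= len w.
Proof.
move=> inv_w; have [n] := ubnP (len x); elim: n x => // n IHn x le_xn.
have [->|x1] := eqVneq x 1; first by rewrite invg1 mul1g len1 addn0.
have [[|s u] szu] := len_word x => def_x.
  by case/eqP: x1; rewrite -def_x big_nil.
set y := wprod u; have {def_x} def_x : x = gen s * y by rewrite -def_x big_cons.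
have len_x : len x = (len y).+1.
  apply/eqP; rewrite eqn_leq -{2}szu ltnS len_prod andbT def_x.
  by apply: leq_trans (lenM _ _) _; rewrite -add1n leq_add2r len_gen.
have /IHn le_yw : len y < n by rewrite -ltnS -len_x.
(* Otherwise x = sy would be shorter than y. *)
have ninv_y : ~~ inversion y (gen s).
  by apply/negP => /len_genM_inversion; rewrite -def_x len_x; lia.
(* Cocycle identity for w = y (y^-1 w). Multiplying y^-1 w by this reflection gives x^-1 w, which is
   therefore shorter. *)
have : inversion (y^-1 * w) (gen s ^ y).
  have := inv_w s; rewrite -{1}(mulVKg y w) inversionM (negPf ninv_y).
  by [].
move/len_inversion; rewrite conjgE def_x invgM coxeter_genV -!mulgA mulVKg.
by rewrite -def_x len_x mulgA; lia.
Qed.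

Lemma finite_of_inversions w :
  (forall s, inversion w (gen s)) -> finite_set [set: W]%classic.
Proof.
move=> inv_w; have le_w x : len x <= len w.
  by apply: leq_trans (len_prefix x inv_w); apply: leq_addl.
apply: (@sub_finite_set _ _ (\bigcup_(n in `I_(len w).+1)
  parabolic_sphere gen [set: S]%SET n)%classic).
  move=> x _; exists (len x); first exact: le_w.
  split=> // H [Hgrp sub_H].
  have [u <-] := coxeter_gen_word hWS x; elim: u => [|s u IHu].
    by rewrite big_nil; case: Hgrp => /set_mem.
  rewrite big_cons; apply/set_mem/(group_closedM Hgrp); apply/mem_set => //.
  by apply: sub_H; exists s; rewrite /= ?inE.
by apply: bigcup_finite => [|n _]; [exact: finite_II|exact: finite_parabolic_sphere].
Qed.

(** * Parabolic subgroups and minimal coset representatives *)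

Section Parabolic.
Variable T : {set S}.

Lemma parabolicP w :
  parabolic gen T w <-> exists2 u, all (mem T) u & wprod u = w.
Proof.
split=> [|[u Tu <-] H [Hgrp sub_H]]; last first.
  elim: u Tu => [_|s u IHu /= /andP[Ts /IHu Hu]].
    by rewrite big_nil; case: Hgrp => /set_mem.
  rewrite big_cons; apply/set_mem/(group_closedM Hgrp); apply/mem_set => //.
  by apply: sub_H; exists s.
pose H := [set x | exists2 u, all (mem T) u & wprod u = x]%classic.
move=> /(_ H) Hw; apply: Hw; split; last first.
  by move=> _ [s Ts <-]; exists [:: s]; rewrite /= ?andbT // big_cons big_nil mulg1.
split=> [|_ _ /set_mem[u Tu <-] /set_mem[v Tv <-]]; apply/mem_set.
  by exists [::]; rewrite // big_nil.
(* Generators being involutions, the reversed word represents the inverse. *)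
exists (u ++ rev v); first by rewrite all_cat Tu all_rev.
rewrite big_cat /=; congr (_ * _); elim: v {Tv} => [|s v IHv].
  by rewrite !big_nil invg1.
by rewrite rev_cons -cats1 big_cat /= !big_cons big_nil mulg1 IHv invgM coxeter_genV.
Qed.

Lemma parabolic1 : parabolic gen T 1.
Proof. by apply/parabolicP; exists [::]; rewrite // big_nil. Qed.

Lemma parabolicM v w :
  parabolic gen T v -> parabolic gen T w -> parabolic gen T (v * w).
Proof.
move=> /parabolicP[a Ta <-] /parabolicP[b Tb <-]; apply/parabolicP.
by exists (a ++ b); rewrite ?big_cat // all_cat Ta.
Qed.

Lemma parabolicV v : parabolic gen T v -> parabolic gen T v^-1.
Proof.
move=> Tv H CH; have Hgrp := proj1 CH.
by apply/set_mem/(group_closedV Hgrp)/mem_set; apply: Tv.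
Qed.

Lemma parabolic_gen s : s \in T -> parabolic gen T (gen s).
Proof.
by move=> Ts; apply/parabolicP; exists [:: s]; rewrite /= ?Ts // big_cons big_nil mulg1.
Qed.

(** If the first letter s of a [T]-word for [w] is not an inversion of [w], it is one of the tail;
    exchange then gives a shorter [T]-word for [w]. *)
Lemma parabolic_descent w : parabolic gen T w -> w != 1 ->
  exists2 s, s \in T & inversion w (gen s).
Proof.
case/parabolicP=> u; have [n] := ubnP (size u).
elim: n u => // n IHn [|s u] /= le_un; first by rewrite big_nil => _ <- /eqP.
rewrite ltnS in le_un.
case/andP=> Ts Tu; rewrite big_cons => def_w w1.
have [|ninv_w] := boolP (inversion w (gen s)); first by exists s.
move: ninv_w; rewrite -def_w inversion_genM negbK inversion_prod.
case/strong_exchange=> v [sub_vu lt_vu def_v].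
rewrite def_w; apply: (IHn v); rewrite ?def_v ?def_w //.
  exact: ltn_trans lt_vu le_un.
by apply/allP => t /(mem_subseq sub_vu)/(allP Tu).
Qed.

(** A local condition on descents; [len_coset_minimal] shows that it characterizes the shortest
    element of W_T w. *)
Definition coset_minimal (w : W) : bool :=
  [forall s in T, ~~ inversion w (gen s)].

(** Induction on the length of [v], stripping a left descent s in [T] that is also a descent of
    [v * u]. *)
Lemma len_shortest_coset u :
    (forall v, parabolic gen T v -> len u <= len (v * u)) ->
  forall v, parabolic gen T v -> len (v * u) = len v + len u.
Proof.
move=> min_u v; have [n] := ubnP (len v); elim: n v => // n IHn v le_vn Tv.
have [->|v1] := eqVneq v 1; first by rewrite mul1g len1.
have [s Ts inv_vs] := parabolic_descent Tv v1.
(* This reflection lies in W_T, so it cannot shorten [u]. *)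
have ninv_u : inversion u (gen s ^ v) = false.
  apply/negP => /len_inversion; rewrite ltnNge min_u //.
  rewrite conjgE; apply: parabolicM; first exact: parabolicV.
  by apply: parabolicM => //; apply: parabolic_gen.
have inv_vu : inversion (v * u) (gen s) by rewrite inversionM inv_vs ninv_u.
rewrite (len_genM_inversion inv_vu) (len_genM_inversion inv_vs) mulgA IHn //.
  by rewrite -ltnS -(len_genM_inversion inv_vs).
by apply: parabolicM => //; apply: parabolic_gen.
Qed.

Lemma shortest_in_coset w : exists2 v, parabolic gen T v &
  forall x, parabolic gen T x -> len (v * w) <= len (x * (v * w)).
Proof.
pose P n := `[< exists2 v, parabolic gen T v & len (v * w) = n >].
have exP : exists n, P n.
  by exists (len (1 * w)); apply/asboolP; exists 1; first exact: parabolic1.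
case: (ex_minnP exP) => n /asboolP[v Tv <-] min_v; exists v => // x Tx.
apply: min_v; apply/asboolP; exists (x * v); last by rewrite mulgA.
exact: parabolicM.
Qed.

(** If vu is shortest in the coset and v is not 1, a descent s of v^-1 in [T] is not one of u = v^-1
    (vu); by the cocycle identity v s v^-1, an element of W_T, would then shorten vu. *)
Lemma len_coset_minimal v u : parabolic gen T v -> coset_minimal u ->
  len (v * u) = len v + len u.
Proof.
move=> Tv min_u; apply: len_shortest_coset => // {v Tv}.
have [v Tv min_vu] := shortest_in_coset u.
suff v1 : v = 1 by move: min_vu; rewrite v1 mul1g.
apply/eqP; rewrite -invg_eq1; apply/negPn/negP => vV1.
have TvV := parabolicV Tv; have [s Ts inv_s] := parabolic_descent TvV vV1.
have := forall_inP min_u s Ts; rewrite -(mulKg v u) inversionM inv_s /=.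
rewrite negbK => /len_inversion; rewrite ltnNge min_vu //.
rewrite conjgE invgK; apply: parabolicM => //.
by apply: parabolicM => //; apply: parabolic_gen.
Qed.

Lemma coset_factorization w : exists p : W * W,
  [/\ parabolic gen T p.1, coset_minimal p.2 & p.1 * p.2 = w].
Proof.
have [v Tv min_vw] := shortest_in_coset w.
exists (v^-1, v * w); split; rewrite ?mulKg //; first exact: parabolicV.
apply/forall_inP => s Ts; apply/negP => /len_inversion.
by rewrite ltnNge min_vw //; apply: parabolic_gen.
Qed.

(** The element x = v'^-1 v of W_T takes [u] to [u'] and x^-1 takes it back; additivity of length
    both ways forces x to have length 0. *)
Lemma coset_factorization_inj v v' u u' :
    parabolic gen T v -> parabolic gen T v' ->
    coset_minimal u -> coset_minimal u' ->
  v * u = v' * u' -> v = v' /\ u = u'.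
Proof.
move=> Tv Tv' min_u min_u' eq_vu.
have Tx : parabolic gen T (v'^-1 * v) by apply: parabolicM; first exact: parabolicV.
have def_u' : u' = (v'^-1 * v) * u by rewrite -mulgA eq_vu mulKg.
have def_u : u = (v'^-1 * v)^-1 * u' by rewrite def_u' mulKg.
have := len_coset_minimal (parabolicV Tx) min_u'; rewrite -def_u.
have := len_coset_minimal Tx min_u; rewrite -def_u' => -> => eq_len.
have /len_eq0 x1 : len (v'^-1 * v) = 0 by lia.
split; last by rewrite def_u' x1 mul1g.
by rewrite -(mulVKg v' v) x1 mulg1.
Qed.

End Parabolic.
End Inversions.

Section FpsCoefficients.
Variable R : comNzRingType.
Local Open Scope ring_scope.

Lemma coefs_sum (I : Type) (r : seq I) (P : pred I) (f : I -> fps R) n :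
  coefs (\sum_(i <- r | P i) f i) n = \sum_(i <- r | P i) coefs (f i) n.
Proof. exact: (big_morph (fun f => coefs f n)). Qed.

Lemma coefs_signM k (f : fps R) n :
  coefs ((-1) ^+ k * f) n = (-1) ^+ k * coefs f n.
Proof.
elim: k => [|k IHk]; first by rewrite !mul1r.
by rewrite !exprS -!mulrA !mulN1r -IHk.
Qed.

End FpsCoefficients.

(** * Factorization of the growth series and sign cancellation *)

Section GrowthFactorization.
Variables (W : groupType) (S : finType) (gen : S -> W).
Hypothesis hWS : coxeter_system gen.
Local Notation len := (word_length gen).

Definition coset_sphere (T : {set S}) (n : nat) : set W :=
  [set w | coset_minimal gen T w /\ len w = n]%classic.

(** This is the quotient W(t)/W_T(t), by [growth_series_factor]. *)
Definition coset_series (T : {set S}) : fps int :=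
  Fps (fun n => (#|` fset_set (coset_sphere T n)|)%:R%R).

Lemma parabolic_setT w : parabolic gen [set: S]%SET w.
Proof.
have [u <-] := coxeter_gen_word hWS w; apply/(parabolicP hWS).
by exists u => //; apply/allP => s; rewrite /= inE.
Qed.

Lemma finite_coset_sphere T n : finite_set (coset_sphere T n).
Proof.
apply: sub_finite_set (finite_parabolic_sphere hWS [set: S]%SET n) => w [_ <-].
by split=> //; apply: parabolic_setT.
Qed.

Lemma mem_parabolic_sphere T n w :
  (w \in fset_set (parabolic_sphere gen T n)) =
    `[< parabolic gen T w >] && (len w == n).
Proof.
rewrite in_fset_set; last exact: finite_parabolic_sphere.
apply/idP/andP => [/set_mem[Tw <-]|[/asboolP Tw /eqP wn]]; last exact/mem_set.
by split; first exact/asboolP.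
Qed.

Lemma mem_coset_sphere T n w :
  (w \in fset_set (coset_sphere T n)) = coset_minimal gen T w && (len w == n).
Proof.
rewrite in_fset_set; last exact: finite_coset_sphere.
apply/idP/andP => [/set_mem[Tw <-]|[Tw /eqP wn]]; last exact/mem_set.
by split.
Qed.

(** Each element factors uniquely, with additive length, into an element of W_T and a minimal
    representative. *)
Lemma growth_series_factor T :
  growth_series gen [set: S]%SET = (growth_series gen T * coset_series T)%R.
Proof.
apply: fpsP => n.
change ((#|` fset_set (parabolic_sphere gen [set: S]%SET n)|%:R : int) =
  \sum_(i < n.+1) #|` fset_set (parabolic_sphere gen T i)|%:R *
                   #|` fset_set (coset_sphere T (n - i))|%:R)%R.
have [f fP] := choice (coset_factorization hWS T).
have Tf w : parabolic gen T (f w).1 by case: (fP w).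
have min_f w : coset_minimal gen T (f w).2 by case: (fP w).
have fK w : ((f w).1 * (f w).2)%g = w by case: (fP w).
have len_f w : len w = len (f w).1 + len (f w).2.
  by rewrite -{1}(fK w) (len_coset_minimal hWS (T := T)).
rewrite -(@sum1_size _ (fset_set _)) natr_sum.
(* Sort by the length of the W_T-factor; it is at most [n] on this sphere, so [inord] truncates
   nothing. *)
rewrite (partition_big (fun w => inord (len (f w).1) : 'I_n.+1) predT) //=.
apply: eq_bigr => i _; rewrite -natrM -natr_sum sum1_count -size_filter.
congr (_%:R)%R; rewrite -(size_allpairs (fun v u => v * u)%g).
apply/perm_size/uniq_perm.
- exact/filter_uniq/fset_uniq.
- apply: allpairs_uniq; rewrite ?fset_uniq // => -[v u] [v' u'].
  move=> /allpairsP[[a b] /= [+ + [-> ->]]] /allpairsP[[c d] /= [+ + [-> ->]]].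
  rewrite !mem_parabolic_sphere !mem_coset_sphere.
  move=> /andP[/asboolP Ta _] /andP[min_b _] /andP[/asboolP Tc _] /andP[min_d _].
  by case/(coset_factorization_inj hWS Ta Tc min_b min_d)=> -> ->.
move=> w; rewrite mem_filter mem_parabolic_sphere (asboolT (parabolic_setT w)) /=.
apply/andP/allpairsP => [[/eqP iE /eqP wn]|[[v u] /= []]].
  have le_fn : len (f w).1 < n.+1 by rewrite ltnS -wn (len_f w) leq_addr.
  exists (f w); rewrite fK mem_parabolic_sphere mem_coset_sphere asboolT //.
  by rewrite min_f -iE inordK // eqxx -wn (len_f w) addKn eqxx.
rewrite mem_parabolic_sphere mem_coset_sphere.
move=> /andP[/asboolP Tv /eqP vi] /andP[min_u /eqP u_ni] def_w.
have [eq_v _] : (f w).1 = v /\ (f w).2 = u.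
  by apply: (coset_factorization_inj hWS (Tf w) Tv) => //; rewrite fK.
rewrite eq_v vi inord_val eqxx def_w (len_coset_minimal hWS Tv min_u) vi u_ni.
by rewrite subnKC // -ltnS.
Qed.

(** The index set no longer depends on [T], which permits exchanging the sums over [T] and [w]. *)
Lemma coefs_coset_series T n :
  (coefs (coset_series T) n =
    \sum_(w <- fset_set (parabolic_sphere gen [set: S]%SET n))
      (coset_minimal gen T w)%:R)%R.
Proof.
rewrite -natr_sum /= -big_mkcond /= sum1_count -size_filter; congr (_%:R)%R.
apply/perm_size/uniq_perm; rewrite ?filter_uniq ?fset_uniq // => w.
rewrite mem_filter mem_coset_sphere mem_parabolic_sphere.
by rewrite (asboolT (parabolic_setT w)).
Qed.

(* Toggling a non-inversion s in T preserves coset minimality and flips the sign. *)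
Lemma sum_sign_coset_minimal w s : ~~ inversion gen w (gen s) ->
  (\sum_(T : {set S}) (-1) ^+ #|T| * (coset_minimal gen T w)%:R = 0 :> int)%R.
Proof.
move=> ninv_s; pose toggle (T : {set S}) := if s \in T then T :\ s else s |: T.
have toggleK : involutive toggle.
  move=> T; rewrite /toggle; case: (boolP (s \in T)) => Ts.
    by rewrite finset.setD11 finset.setD1K.
  by rewrite finset.setU11 finset.setU1K // Ts.
have min_toggle T : coset_minimal gen (toggle T) w = coset_minimal gen T w.
  (* Adding s to a set is harmless, since s is not an inversion of [w]. *)
  have sub (A B : {set S}) : B \subset s |: A ->
      coset_minimal gen A w -> coset_minimal gen B w.
    move=> /fintype.subsetP sBA /forall_inP min_A; apply/forall_inP => t /sBA.
    by case/finset.setU1P => [->//|/min_A].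
  apply/idP/idP; apply: sub; rewrite /toggle; case: ifP => Ts.
  - by rewrite finset.setD1K.
  - by rewrite finset.setUA finset.setUid finset.subsetUr.
  - by rewrite (fintype.subset_trans (finset.subsetDl _ _)) // finset.subsetUr.
  - exact: subxx.
set E := (X in X = 0%R); suff : E = (- E)%R by lia.
rewrite {1}/E (reindex_inj (inv_inj toggleK)) -sumrN; apply: eq_bigr => T _ /=.
rewrite min_toggle -mulNr; congr (_ * _)%R; rewrite /toggle.
case: ifP => Ts; last by rewrite finset.cardsU1 Ts exprS mulN1r.
by rewrite [in RHS](finset.cardsD1 s T) Ts exprS mulN1r opprK.
Qed.

End GrowthFactorization.

(** * Vanishing of the alternating sum *)

Local Open Scope ring_scope.

Theorem mainTheorem1 (W : groupType) (S : finType) (gen : S -> W)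
    (hWS : coxeter_system gen) (hW : infinite_set [set: W]%classic) :
  \sum_(T : {set S}) (-1) ^+ #|T| / growth_series gen T = 0 :> fps int.
Proof.
have unitG T := growth_series_unit hWS T.
apply: (mulIr (unitG [set: S]%SET)); rewrite mul0r mulr_suml.
transitivity (\sum_(T : {set S}) (-1) ^+ #|T| * coset_series gen T).
  by apply: eq_bigr => T _; rewrite (growth_series_factor hWS T) -mulrA mulKr.
apply: fpsP => n; rewrite coefs_sum.
under eq_bigr do rewrite coefs_signM coefs_coset_series // mulr_sumr.
rewrite exchange_big big1 //= => w _.
have [s ninv_s] : exists s, ~~ inversion gen w (gen s).
  apply: contrapT => /forallNP inv_w; apply: hW.
  by apply: (finite_of_inversions hWS (w := w)) => s; apply/negPn/negP/inv_w.
exact: sum_sign_coset_minimal ninv_s.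
Qed.
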